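(* Let $P$ be an $r$-differential poset and $Q$ an $s$-differential poset, with rank sizes $p_n$ and $q_n$ respectively. Suppose that $\Delta q_n\ge\Delta q_{n-1}$ for all $n\ge2$, and that all the down maps of at least one of $P$, $Q$ are surjective (over $\mathbb{Z}$). Then for the Cartesian product poset $P\times Q$ and every $n\ge0$, the matrix $[DU_n]+xI$ (where $DU_n$ is computed in $P\times Q$ and $I$ is the identity of size equal to the $n$-th rank size of $P\times Q$) has Smith normal form over $\mathbb{Z}[x]$.
   Context: For a positive integer $r$, a poset $P$ is $r$-differential if: (D1) $P$ is graded, locally finite, has all rank sizes finite and a unique minimum element; (D2) if two distinct elements of $P$ both cover exactly $k$ common elements, then exactly $k$ elements cover them both; (D3) if an element covers $k$ elements then it is covered by exactly $k+r$ elements. $P_n$ is the $n$-th rank (empty for $n<0$), $p_n=|P_n|$, $\Delta p_n=p_n-p_{n-1}$. $\mathbb{Z}P_n$ is the free $\mathbb{Z}$-module with basis $P_n$; $U_n:\mathbb{Z}P_n\to\mathbb{Z}P_{n+1}$ sends an element to the sum of all elements covering it, $D_n:\mathbb{Z}P_n\to\mathbb{Z}P_{n-1}$ sends an element to the sum of all elements it covers, $DU_n=D_{n+1}U_n$, and $[DU_n]$ is its matrix in the standard basis. $P\times Q$ is the product poset with componentwise order (it is $(r+s)$-differential). A matrix over a commutative ring $R$ has Smith normal form over $R$ if it can be multiplied on both sides by invertible matrices over $R$ to obtain a diagonal matrix whose diagonal entries satisfy $s_1\mid s_2\mid\cdots$. *)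

(* Defs.v *)
From HB Require Import structures.
From mathcomp Require Import all_boot all_order all_algebra.
Set Implicit Arguments. Unset Strict Implicit. Unset Printing Implicit Defensive.
Import Order.TTheory GRing.Theory Num.Theory.

(* A graded poset given by its ranks and its covering relation between
   consecutive ranks: elt n = P_n (a finite set), cov n x y <=> y covers x
   (x in P_n, y in P_{n+1}).  In a graded poset covers only occur between
   consecutive ranks, and the order is the reflexive-transitive closure. *)
Record gposet := GPoset {
  elt : nat -> finType;
  cov : forall n, elt n -> elt n.+1 -> bool }.

Arguments cov {g n}.

Definition ndown (P : gposet) (n : nat) : elt P n -> nat :=
  match n as m return elt P m -> nat with
  | 0 => fun _ => 0
  | m.+1 => fun x => #|[pred w : elt P m | cov w x]|
  end.

Definition ncommon_down (P : gposet) (n : nat) : elt P n -> elt P n -> nat :=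
  match n as m return elt P m -> elt P m -> nat with
  | 0 => fun _ _ => 0
  | m.+1 => fun x y => #|[pred w : elt P m | cov w x && cov w y]|
  end.

(* r-differential poset (D1)-(D3).  D1: graded with finite ranks (built in),
   unique minimum: P_0 is a singleton and every element of positive rank
   covers some element.  D2 only concerns elements of equal rank, since in a
   graded poset elements of different ranks have no common cover and cover no
   common element. *)
Definition differential (r : nat) (P : gposet) : Prop :=
  [/\ 0 < r,
      #|elt P 0| = 1,
      (forall n (y : elt P n.+1), exists x : elt P n, cov x y),
      (forall n (x y : elt P n), x != y ->
          #|[pred z : elt P n.+1 | cov x z && cov y z]| = ncommon_down x y)
    & (forall n (x : elt P n),
          #|[pred z : elt P n.+1 | cov x z]| = ndown x + r)].

Definition rksize (P : gposet) (n : nat) : nat := #|elt P n|.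

(* all down maps D_{n+1} : Z P_{n+1} -> Z P_n are surjective over Z
   (D_0 has target 0 and is trivially surjective). *)
Definition down_surjective (P : gposet) : Prop :=
  forall n (v : elt P n -> int), exists w : elt P n.+1 -> int,
    forall y : elt P n, v y = (\sum_(x : elt P n.+1 | cov y x) w x)%R.

Definition telt (P : gposet) := {n : nat & elt P n}.

Definition tcov (P : gposet) (u v : telt P) : bool :=
  [exists x : elt P (tag u), exists y : elt P (tag u).+1,
     [&& Tagged (elt P) x == u, Tagged (elt P) y == v & cov x y]].

Definition prod_elt (P Q : gposet) (n : nat) : finType :=
  {i : 'I_n.+1 & (elt P i * elt Q (n - i))%type}.

Definition prod_pair (P Q : gposet) (n : nat) (x : prod_elt P Q n)
  : telt P * telt Q :=
  (Tagged (elt P) (tagged x).1, Tagged (elt Q) (tagged x).2).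

Definition prod_cov (P Q : gposet) (n : nat)
  (x : prod_elt P Q n) (y : prod_elt P Q n.+1) : bool :=
  let u := prod_pair x in let v := prod_pair y in
  (tcov u.1 v.1 && (u.2 == v.2)) || ((u.1 == v.1) && tcov u.2 v.2).

Definition prod_poset (P Q : gposet) : gposet :=
  GPoset (@prod_cov P Q).

(* matrix of DU_n = D_{n+1} U_n in the standard basis (indexed via enum_val),
   with entries in Z[x]: entry (x,y) = coefficient of x in D U y
   = number of z in P_{n+1} covering both x and y. *)
Definition DUmx (P : gposet) (n : nat) : 'M[{poly int}]_#|elt P n| :=
  \matrix_(i, j) (#|[pred z : elt P n.+1 |
        cov (enum_val i) z && cov (enum_val j) z]|)%:R%R.

Definition rdvd (R : comNzRingType) (a b : R) : Prop := exists c : R, b = (c * a)%R.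

Definition has_SNF (R : comUnitRingType) (k : nat) (A : 'M[R]_k) : Prop :=
  exists (M N : 'M[R]_k),
    [/\ M \in unitmx, N \in unitmx,
        is_diag_mx (M *m A *m N)
      & forall i j : 'I_k, (i <= j)%N ->
          rdvd ((M *m A *m N) i i) ((M *m A *m N) j j)].

(* Main.v *)
Require Import Defs.
From HB Require Import structures.
From mathcomp Require Import all_boot all_order all_algebra.
From mathcomp Require Import zify ring.
Import Order.TTheory GRing.Theory Num.Theory.

(** The product T = P x Q is again differential, with constant R = r + s, and
    its down maps D are surjective; dually the up maps U are split injective.
    Regard Z T_n as a Z[x]-module with x acting by - D U. Since
    U^j D^j = U D (U D - R) ... (U D - (j - 1) R), the matrix has a Smith form
    as soon as Z T_n has a basis made of strings v, U D v, U^2 D^2 v, ...,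
    where string i is killed by D^(l_i). Such generators v are built by
    induction on n: lift those of rank n - 1 through D and complete them by
    elements of ker D, so that together they form a basis of coker U. The
    lifting problem amounts to finding F with [0; A] + F B unimodular, where
    the rows of A and B together span; this is solvable over Z as soon as there
    are strictly more generators in rank n than in rank n - 1. That strict
    inequality, t_(n+2) + t_n > 2 t_(n+1) for the rank sizes t of the product,
    is where the hypothesis on Q enters; it says nothing about rank 1, where
    the only exceptional case R = 2 is settled by hand. *)

Set Implicit Arguments.
Unset Strict Implicit.
Unset Printing Implicit Defensive.
Local Open Scope ring_scope.

(** * Row spans over a commutative ring *)

Section RowCombinations.
Variable K : comNzRingType.

(** The recurring instance [row_comb 1%:M B] says that [B] has a left inverse, so that its rows span
    everything; for square [B] it means invertibility. *)
Definition row_comb m k n (A : 'M[K]_(m, n)) (B : 'M[K]_(k, n)) : Prop :=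
  exists N : 'M[K]_(m, k), A = N *m B.

Lemma row_comb_refl m n (A : 'M[K]_(m, n)) : row_comb A A.
Proof. by exists 1%:M; rewrite mul1mx. Qed.

Lemma row_comb_trans m k l n (A : 'M[K]_(m, n)) (B : 'M[K]_(k, n))
    (C : 'M[K]_(l, n)) : row_comb A B -> row_comb B C -> row_comb A C.
Proof. by move=> [N ->] [M ->]; exists (N *m M); rewrite mulmxA. Qed.

Lemma row_comb_mull l m k n (N : 'M[K]_(l, m)) (A : 'M[K]_(m, n))
    (B : 'M[K]_(k, n)) : row_comb A B -> row_comb (N *m A) B.
Proof. by move=> [M ->]; exists (N *m M); rewrite mulmxA. Qed.

Lemma row_comb_mulr m k n p (C : 'M[K]_(n, p)) (A : 'M[K]_(m, n))
    (B : 'M[K]_(k, n)) : row_comb A B -> row_comb (A *m C) (B *m C).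
Proof. by move=> [M ->]; exists M; rewrite mulmxA. Qed.

Lemma row_combB m k n (A A' : 'M[K]_(m, n)) (B : 'M[K]_(k, n)) :
  row_comb A B -> row_comb A' B -> row_comb (A - A') B.
Proof. by move=> [M ->] [N ->]; exists (M - N); rewrite mulmxBl. Qed.

Lemma row_combZ m k n (a : K) (A : 'M[K]_(m, n)) (B : 'M[K]_(k, n)) :
  row_comb A B -> row_comb (a *: A) B.
Proof. by move=> [M ->]; exists (a *: M); rewrite scalemxAl. Qed.

Lemma row_comb_up m k l n (A : 'M[K]_(m, n)) (B : 'M[K]_(k, n))
    (C : 'M[K]_(l, n)) : row_comb A B -> row_comb A (col_mx B C).
Proof. by move=> [M ->]; exists (row_mx M 0); rewrite mul_row_col mul0mx addr0. Qed.

Lemma row_comb_down m k l n (A : 'M[K]_(m, n)) (B : 'M[K]_(k, n))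
    (C : 'M[K]_(l, n)) : row_comb A C -> row_comb A (col_mx B C).
Proof. by move=> [M ->]; exists (row_mx 0 M); rewrite mul_row_col mul0mx add0r. Qed.

Lemma row_comb_col m k l n (A : 'M[K]_(m, n)) (B : 'M[K]_(k, n))
    (C : 'M[K]_(l, n)) : row_comb A C -> row_comb B C -> row_comb (col_mx A B) C.
Proof. by move=> [M ->] [N ->]; exists (col_mx M N); rewrite mul_col_mx. Qed.

End RowCombinations.

Lemma row_comb_map (K L : comNzRingType) (f : {rmorphism K -> L}) m k n
    (A : 'M[K]_(m, n)) (B : 'M[K]_(k, n)) :
  row_comb A B -> row_comb (map_mx f A) (map_mx f B).
Proof. by move=> [M ->]; exists (map_mx f M); rewrite map_mxM. Qed.

(** * Unimodular completion over the integers *)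

Lemma int_row_echelon n a (H : 'M[int]_(n, a)) :
  exists2 L : 'M[int]_n, L \in unitmx &
    forall i : 'I_n, (a <= i)%N -> row i (L *m H) = 0.
Proof.
have [L uL [R _ [d _ ->]]] := int_Smith_normal_form H.
exists (invmx L); first by rewrite unitmx_inv.
move=> i le_ai; rewrite -!mulmxA mulKmx // row_mul.
suff -> : row i (\matrix_(i, j) (d`_i *+ (i == j :> nat)) : 'M_(n, a)) = 0.
  by rewrite mul0mx.
apply/rowP => j; rewrite !mxE gtn_eqF ?mulr0n //.
exact: leq_trans (ltn_ord j) le_ai.
Qed.

(** Together, [col_mx W Z] and [row_mx A S] are mutually inverse. The rows of [Z] form a basis of
    the left kernel of [A], read off from the rows of [L] that [int_row_echelon] makes vanish on
    [A]. *)
Lemma left_inverse_split t' m t (W : 'M[int]_(t', t)) (A : 'M[int]_(t, t')) :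
  W *m A = 1%:M -> (t' + m = t)%N ->
  exists (Z : 'M[int]_(m, t)) (S : 'M[int]_(t, m)),
    [/\ Z *m A = 0, Z *m S = 1%:M, W *m S = 0 & A *m W + S *m Z = 1%:M].
Proof.
move=> WA et; case: t / et W A WA => W A WA.
have [L uL zL] := int_row_echelon A.
pose Li := invmx L; pose L1 := usubmx L; pose Z := dsubmx L.
pose M1 := lsubmx Li; pose M2 := rsubmx Li.
have EL : L = col_mx L1 Z by rewrite vsubmxK.
have ELi : Li = row_mx M1 M2 by rewrite hsubmxK.
have ZA : Z *m A = 0.
  apply/row_matrixP => i; rewrite row0 /Z mul_dsub_mx row_dsubmx.
  by apply: zL; rewrite /= leq_addr.
have ZM2 : Z *m M2 = 1%:M.
  have := mulmxV uL; rewrite -/Li {1}EL ELi mul_col_row (@scalar_mx_block _ t' m).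
  by case/eq_block_mx.
have : Li *m L = 1%:M by rewrite mulVmx.
rewrite EL ELi mul_row_col => MLZ.
have AE : A = M1 *m (L1 *m A).
  by rewrite -{1}[A]mul1mx -MLZ mulmxDl -!mulmxA ZA mulmx0 addr0.
have M1E : M1 = A *m W *m M1.
  have : (W *m M1) *m (L1 *m A) = 1%:M by rewrite -mulmxA -AE.
  move/mulmx1C => E.
  by rewrite {1}AE -mulmxA -mulmxA E mulmx1.
(* [M2] is already a right inverse of [Z]; removing its [A *m W] component gives [W *m S = 0] and
   keeps [Z *m S = 1%:M], because [Z *m A = 0]. *)
exists Z, (M2 - A *m W *m M2); split=> //.
- by rewrite mulmxBr ZM2 !mulmxA ZA !mul0mx subr0.
- by rewrite mulmxBr !mulmxA WA mul1mx subrr.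
have M2Z : M2 *m Z = 1%:M - M1 *m L1 by rewrite -MLZ addrAC subrr add0r.
rewrite mulmxBl -(mulmxA (A *m W) M2 Z) M2Z mulmxBr mulmx1 mulmxA -M1E opprB.
by rewrite addrC -!addrA addNr addr0 addNr addr0.
Qed.

Lemma absorb_row n a (H : 'M[int]_(n, a)) (tau : 'rV[int]_a) :
  (a < n)%N -> row_comb 1%:M (col_mx H tau) ->
  exists f : 'cV[int]_n, row_comb 1%:M (H + f *m tau).
Proof.
move=> lt_an spanHt; have [L uL zL] := int_row_echelon H.
(* Row [a] of [L *m H] vanishes, so [tau] becomes row [a] of [L *m (H + f *m tau)]; subtracting
   [f *m tau] then recovers [H]. *)
pose i0 := Ordinal lt_an; pose f := invmx L *m delta_mx i0 0 : 'cV[int]_n.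
exists f; have tauE : row i0 L *m (H + f *m tau) = tau.
  rewrite -row_mul mulmxDr linearD /= zL // add0r mulmxA mulKVmx //.
  by rewrite row_mul rowE mul_delta_mx; apply/rowP=> j; rewrite mxE big_ord1 !mxE eqxx mul1r.
have taus : row_comb tau (H + f *m tau) by exists (row i0 L).
apply: row_comb_trans spanHt (row_comb_col _ taus).
rewrite -[X in row_comb X _](addrK (f *m tau)).
by apply: row_combB (row_comb_refl _) (row_comb_mull _ taus).
Qed.

(* Rows of T are absorbed one at a time: a matrix with more rows than columns
   has, up to a unimodular change, a zero row that can host the new one. *)
Lemma absorb_rows k n a (H : 'M[int]_(n, a)) (T : 'M[int]_(k, a)) :
  (a < n)%N -> row_comb 1%:M (col_mx H T) ->
  exists F : 'M[int]_(n, k), row_comb 1%:M (H + F *m T).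
Proof.
move=> lt_an; elim: k H T => [|k IHk] H T.
  move=> spanHT; exists 0; rewrite mul0mx addr0; apply: row_comb_trans spanHT _.
  by apply: row_comb_col (row_comb_refl _) _; exists 0; rewrite mul0mx [T]flatmx0.
rewrite -[T](@vsubmxK _ 1 k); set tau := usubmx _; set T1 := dsubmx _ => spanHT.
have [|f] := @absorb_row (n + k) a (col_mx H T1) tau (ltn_addr _ lt_an).
  apply: row_comb_trans spanHT _; apply: row_comb_col.
    by apply/row_comb_up/row_comb_up/row_comb_refl.
  apply: (@row_comb_col _ 1 k); first exact/row_comb_down/row_comb_refl.
  by apply/row_comb_up/row_comb_down/row_comb_refl.
rewrite -[f]vsubmxK mul_col_mx add_col_mx => spanf.
have [F spanF] := IHk _ _ spanf.
(* Absorbing [tau] also added [dsubmx f *m tau] to [T1], which [F] then multiplies; the first column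
   collects both coefficients of [tau]. *)
exists (row_mx (usubmx f + F *m dsubmx f) F).
suff -> : H + row_mx (usubmx f + F *m dsubmx f) F *m col_mx tau T1 =
  H + usubmx f *m tau + F *m (T1 + dsubmx f *m tau) by [].
by rewrite mul_row_col mulmxDl mulmxDr mulmxA -!addrA [F *m T1 + _]addrC.
Qed.

(** The left kernel of [Z] has rank one, with basis a row [K]; a column [f] with [K *m f = 1] and
    [W *m f = 0] makes [col_mx K W] a left inverse of [row_mx f Z]. *)
Lemma unimodular_completion a (Z : 'M[int]_(1 + a, a)) :
  row_comb 1%:M Z -> exists f : 'cV[int]_(1 + a), row_comb 1%:M (row_mx f Z).
Proof.
move=> [W WZ]; have [|K [f [KZ Kf Wf _]]] := @left_inverse_split a 1 (1 + a) W Z (esym WZ).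
  by rewrite addnC.
exists f; exists (col_mx K W).
by rewrite mul_col_row KZ Kf Wf -WZ -scalar_mx_block.
Qed.

(** Row [m'] of [L *m Q^T] vanishes, so the transpose of row [m'] of [L] is killed by [Q]. It is
    primitive as a row of a unimodular matrix; the matching column of the inverse supplies [u]. *)
Lemma primitive_annihilator m' m (Q : 'M[int]_(m', m)) : (m' < m)%N ->
  exists (c : 'cV[int]_m) (u : 'rV[int]_m), Q *m c = 0 /\ u *m c = 1%:M.
Proof.
move=> lt_m'm; have [L uL zL] := int_row_echelon Q^T.
pose i0 := Ordinal lt_m'm.
exists (row i0 L)^T, (col i0 (invmx L))^T; split.
  by apply: trmx_inj; rewrite trmx_mul trmxK -row_mul zL // trmx0.
apply: trmx_inj; rewrite trmx_mul !trmxK trmx1 -row_mul.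
rewrite colE mulmxA mulmxV // mul1mx; apply/matrixP=> i j.
by rewrite !ord1 !mxE !eqxx.
Qed.

(* A primitive vector c killed by Q forces the row span of T to contain some
   tau with tau *m c = 1; modulo tau there is one column less, so the rows of T
   can be absorbed, and the tau-coordinate is free to complete the result to a
   square unimodular matrix. *)
Lemma unimodular_lift d m' k (Q : 'M[int]_(m', d.+1 + m'))
    (T : 'M[int]_(k, d.+1 + m')) :
  row_comb 1%:M (col_mx Q T) ->
  exists F : 'M[int]_(d.+1 + m', k), row_comb 1%:M (col_mx 0 Q + F *m T).
Proof.
set m := (d.+1 + m')%N; set a := (d + m')%N.
have em : m = (1 + a)%N by [].
move=> [N]; rewrite -[N]hsubmxK mul_row_col.
set N1 := lsubmx N; set N2 := rsubmx N => spanQT.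
have [|c [u [Qc uc]]] := @primitive_annihilator m' m Q; first by rewrite em ltnS leq_addl.
pose H : 'M[int]_m := col_mx 0 Q.
have Hc : H *m c = 0 by rewrite mul_col_mx mul0mx Qc col_mx0.
(* Since [1 = N1 Q + N2 T] and [Q c = 0], inserting this between [u] and [c] gives
   [tau c = u c = 1]. *)
pose tau := u *m N2 *m T.
have tauc : tau *m c = 1%:M.
  by rewrite -uc -[u in RHS]mulmx1 spanQT mulmxDr mulmxDl -!mulmxA Qc !mulmx0 add0r !mulmxA.
have tauE : u *m N2 *m T = tau by [].
clearbody tau.
have [Z [S [Zc ZS tS ctSZ]]] := @left_inverse_split 1 a m tau c tauc (esym em).
have HE : H = H *m S *m Z.
  by rewrite -[LHS]mulmx1 -ctSZ mulmxDr !mulmxA Hc mul0mx add0r.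
have TE : T = T *m c *m tau + T *m S *m Z.
  by rewrite -[LHS]mulmx1 -ctSZ mulmxDr !mulmxA.
(* [H] is square, so with one column less it has more rows than columns, as [absorb_rows]
   requires. *)
have [|F2 spanF2] := @absorb_rows k m a (H *m S) (T *m S) (ltnSn _).
  exists (row_mx (Z *m row_mx 0 N1) (Z *m N2)).
  rewrite mul_row_col !mulmxA -!mulmxDl -ZS; congr (_ *m _).
  rewrite -[LHS]mulmx1 spanQT mulmxDr !mulmxA; congr (_ + _).
  by rewrite -[Z *m row_mx _ _ *m H]mulmxA mul_row_col mul0mx add0r mulmxA.
have [f [M Mf]] := unimodular_completion spanF2.
(* As [u *m N2 *m T = tau] and [tau *m S = 0], the correction alters only the [tau] component of
   [F *m T], which it sets to [f]. *)
pose F := F2 + (f - F2 *m T *m c) *m (u *m N2).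
exists F; have -> : H + F *m T = row_mx f (H *m S + F2 *m (T *m S)) *m col_mx tau Z.
  rewrite mul_row_col mulmxDl -[X in _ + (_ + X)]mulmxA tauE.
  rewrite mulmxBl {1}HE {1}TE.
  rewrite mulmxDr mulmxDl !mulmxA.
  set x1 := _ *m Z; set x2 := _ *m tau; set x3 := _ *m Z; set x4 := f *m tau.
  by rewrite [x2 + x3]addrC -(addrA x3) [x2 + _]addrC subrK addrA addrC.
exists (row_mx c S *m M).
rewrite -!mulmxA [M *m _]mulmxA -Mf mul1mx mul_row_col.
by rewrite ctSZ.
Qed.

(** Right multiplication by [U^T] is D, and the rows of [K] below form a basis of its kernel. The
    kernel of right multiplication by [K^T] is the row span of [U], so spanning modulo [U] can be
    tested after it. Lifts have the form [V' *m W] plus kernel terms from [F *m K], and their images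
    are of the shape treated by [unimodular_lift]. *)
Lemma lift_generators d m' t' t (U W : 'M[int]_(t', t)) (V' : 'M[int]_(m', t')) :
  W *m U^T = 1%:M -> row_comb 1%:M (col_mx V' (U *m U^T)) ->
  (t' + (d.+1 + m') = t)%N ->
  exists (Vb : 'M[int]_(d.+1, t)) (Va : 'M[int]_(m', t)),
    [/\ Vb *m U^T = 0, Va *m U^T = V' & row_comb 1%:M (col_mx (col_mx Vb Va) U)].
Proof.
move=> WU [N]; rewrite -[N]hsubmxK mul_row_col.
set N1 := lsubmx N; set N2 := rsubmx N => spanV et.
have [K [S [KU KS WS UWSK]]] := left_inverse_split WU et.
have UK : U *m K^T = 0 by apply: trmx_inj; rewrite trmx_mul trmxK KU trmx0.
have SK : S^T *m K^T = 1%:M by rewrite -trmx_mul KS trmx1.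
have WUKS : W^T *m U + K^T *m S^T = 1%:M.
  by rewrite -[in W^T *m U](trmxK U) -!trmx_mul -linearD /= UWSK trmx1.
pose T := K *m K^T.
have UWK : U^T *m W *m K^T = K^T - S *m T.
  by rewrite -[in RHS](mul1mx K^T) -UWSK mulmxDl -!mulmxA addrK.
have WK : W *m K^T = N1 *m (V' *m W *m K^T) - N2 *m U *m S *m T.
  rewrite -{1}[W]mul1mx spanV !mulmxDl !mulmxA; congr (_ + _).
  by rewrite -!mulmxA [U^T *m _]mulmxA UWK !mulmxBr UK mulmx0 sub0r !mulmxA.
have [|F [M MF]] := @unimodular_lift d m' _ (V' *m W *m K^T) T.
  (* Coefficients of [1 = S^T K^T], found by substituting [K^T = U^T W K^T + S T] and expanding
     [W K^T] by [WK]. *)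
  exists (row_mx (S^T *m U^T *m N1) (S^T *m S - S^T *m U^T *m (N2 *m U *m S))).
  rewrite mul_row_col mulmxBl addrCA -!(mulmxA (S^T *m U^T)) -mulmxBr -WK.
  rewrite -!mulmxA -mulmxDr -SK; congr (_ *m _).
  by rewrite [_ *m (W *m _)]mulmxA UWK -/T addrC subrK.
pose Vb := usubmx F *m K; pose Va := V' *m W + dsubmx F *m K.
exists Vb, Va; split.
- by rewrite -mulmxA KU mulmx0.
- by rewrite mulmxDl -!mulmxA KU WU mulmx0 mulmx1 addr0.
have VK : col_mx Vb Va *m K^T = col_mx 0 (V' *m W *m K^T) + F *m T.
  rewrite -{1}[F]vsubmxK mul_col_mx mul_col_mx add_col_mx add0r mulmxDl.
  by rewrite !mulmxA.
(* What the tentative left inverse misses; it is killed by [K^T], hence lies in the row span of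
   [U]. *)
pose u := 1%:M - K^T *m M *m col_mx Vb Va.
have uK : u *m K^T = 0.
  by rewrite mulmxBl mul1mx -!mulmxA VK -MF mulmx1 subrr.
have uE : u = u *m W^T *m U.
  by rewrite -[LHS]mulmx1 -WUKS mulmxDr !mulmxA uK mul0mx addr0.
exists (row_mx (K^T *m M) (u *m W^T)).
by rewrite mul_row_col -uE addrC subrK.
Qed.

(** * Cyclic decompositions and their lifting from rank to rank *)

Local Notation "A ^z" := (map_mx intr A) (at level 8, format "A ^z") : ring_scope.

(* For y = 'X this says that Z^t, as a Z['X]-module on which 'X acts by - A, is
   the direct sum of the cyclic modules generated by the rows of V, the i-th one
   with annihilator g_i. *)
Definition smith_generators t m (A : 'M[int]_t) (V : 'M[int]_(m, t)) : Prop :=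
  forall (K : comNzRingType) (y : K),
  exists (k : nat) (g : 'rV[K]_m) (X1 : 'M[K]_(k, t)) (X2 : 'M[K]_(m, t)),
    [/\ (k + m = t)%N, row_comb 1%:M (col_mx X1 X2),
        row_comb 1%:M (col_mx (X1 *m (A^z + y%:M)) V^z),
        X2 *m (A^z + y%:M) = diag_mx g *m V^z
      & forall i j : 'I_m, (i <= j)%N -> rdvd (g 0 i) (g 0 j)].

(** Specialised to the integers at [y = 0], the generators span the cokernel of [A], as
    [lift_generators] asks of [V']. *)
Lemma smith_generators_span t m (A : 'M[int]_t) (V : 'M[int]_(m, t)) :
  smith_generators A V -> row_comb 1%:M (col_mx V A).
Proof.
move=> /(_ int 0) [k [g [X1 [_ [_ _ spanXV _ _]]]]].
have intz_mx n p (B : 'M[int]_(n, p)) : B^z = B.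
  by apply/matrixP=> i j; rewrite mxE intz.
rewrite !intz_mx raddf0 addr0 in spanXV.
apply: row_comb_trans spanXV (row_comb_col _ _).
  exact/row_comb_down/row_comb_mull/row_comb_refl.
exact/row_comb_up/row_comb_refl.
Qed.

(** Writing [B] for the matrix, [col_mx X1 X2 *m B] is the block diagonal of [1%:M] and [diag_mx g]
    times [col_mx (X1 *m B) V^z]. Both spanning matrices are square with a left inverse, hence
    invertible. *)
Lemma smith_generators_SNF t m (A : 'M[int]_t) (V : 'M[int]_(m, t))
    (K : comUnitRingType) (y : K) :
  smith_generators A V -> has_SNF (A^z + y%:M).
Proof.
move=> /(_ K y) [k [g [X1 [X2 [ekm [NX NXE] [NV NVE] X2A chain]]]]].
case: t / ekm A V X1 X2 NX NXE NV NVE X2A => A V X1 X2 NX NXE NV NVE X2A.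
set B := A^z + y%:M in NVE X2A *.
have DE : col_mx X1 X2 *m B *m NV = block_mx 1%:M 0 0 (diag_mx g).
  have -> : col_mx X1 X2 *m B =
      block_mx 1%:M 0 0 (diag_mx g) *m col_mx (X1 *m B) V^z.
    by rewrite mul_block_col mul_col_mx X2A !mul0mx mul1mx addr0 add0r.
  by rewrite -mulmxA (mulmx1C (esym NVE)) mulmx1.
exists (col_mx X1 X2), NV; rewrite DE; split.
- by case: (mulmx1_unit (esym NXE)).
- by case: (mulmx1_unit (esym NVE)).
- apply/is_diag_mxP => i j.
  case: (split_ordP i) => i' ->; case: (split_ordP j) => j' ->.
  + by rewrite block_mxEul mxE -val_eqE => /negPf /= ->.
  + by rewrite block_mxEur mxE.
  + by rewrite block_mxEdl mxE.
  + by rewrite block_mxEdr mxE /= eqn_add2l val_eqE => /negPf ->.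
- move=> i j; case: (split_ordP i) => i' ->; case: (split_ordP j) => j' ->;
    rewrite ?block_mxEul ?block_mxEdr !mxE !eqxx !mulr1n /=.
  + by exists 1; rewrite mulr1.
  + by exists (g 0 j'); rewrite mulr1.
  + by rewrite leqNgt ltn_addr.
  + by rewrite leq_add2l => /chain.
Qed.

(** With [z = y + R], the relation [U A = A' U] transports the decomposition upwards. Rows of [Vb],
    being in the kernel of D, are eigenvectors for [z]; each lifted string gains one step, so its
    factor [g'], taken at [z], becomes [z g']. *)
Lemma smith_generators_step t' t m' d (U : 'M[int]_(t', t)) (R : int)
    (V' : 'M[int]_(m', t')) (Vb : 'M[int]_(d, t)) (Va : 'M[int]_(m', t)) :
  smith_generators (U *m U^T) V' -> Vb *m U^T = 0 -> Va *m U^T = V' ->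
  row_comb 1%:M (col_mx (col_mx Vb Va) U) -> (t' + (d + m') = t)%N ->
  smith_generators (U^T *m U + R%:M) (col_mx Vb Va).
Proof.
move=> genV' VbU VaU spanVU et K y.
pose z : K := y + R%:~R.
have [k' [g' [X1' [X2' [ek spanX' spanV' X2A' chain]]]]] := genV' K z.
set A' := (U *m U^T)^z + z%:M in spanV' X2A'.
set A := (U^T *m U + R%:M)^z + y%:M.
have AE : A = U^T^z *m U^z + z%:M.
  by rewrite /A map_mxD map_mxM map_scalar_mx -addrA -raddfD /= [R%:~R + _]addrC.
have UA : U^z *m A = A' *m U^z.
  by rewrite AE /A' map_mxM mulmxDr mulmxDl !mulmxA scalar_mxC.
have VbA : Vb^z *m A = z *: Vb^z.
  by rewrite AE mulmxDr mulmxA -map_mxM VbU map_mx0 mul0mx add0r mul_mx_scalar.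
have VaA : Va^z *m A = V'^z *m U^z + z *: Va^z.
  by rewrite AE mulmxDr mulmxA -map_mxM VaU mul_mx_scalar.
have := @row_comb_map int K intr _ _ _ _ _ spanVU.
rewrite map_mx1 !map_col_mx => {}spanVU.
have spanUX : row_comb U^z (col_mx (X1' *m U^z) (X2' *m U^z)).
  by rewrite -mul_col_mx -[X in row_comb X _]mul1mx; apply: row_comb_mulr.
have spanUV : row_comb U^z (col_mx (X1' *m A' *m U^z) (V'^z *m U^z)).
  by rewrite -mul_col_mx -[X in row_comb X _]mul1mx; apply: row_comb_mulr.
(* In the second block of [X2], the term [X2' U] cancels the contribution [g' V' U] of [g' Va A],
   leaving [z g' Va]. *)
exists (m' + k')%N, (row_mx (const_mx z) (z *: g')),
  (col_mx Va^z (X1' *m U^z)), (col_mx Vb^z (diag_mx g' *m Va^z - X2' *m U^z)).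
split.
- by rewrite -et -ek; lia.
- have hVa : row_comb Va^z (col_mx (col_mx Va^z (X1' *m U^z))
                        (col_mx Vb^z (diag_mx g' *m Va^z - X2' *m U^z))).
    exact/row_comb_up/row_comb_up/row_comb_refl.
  apply: row_comb_trans spanVU (row_comb_col (row_comb_col _ hVa) _).
    exact/row_comb_down/row_comb_up/row_comb_refl.
  apply: row_comb_trans spanUX (row_comb_col _ _).
    exact/row_comb_up/row_comb_down/row_comb_refl.
  rewrite -[X in row_comb X _](subKr (diag_mx g' *m Va^z)).
  apply: row_combB; first exact: row_comb_mull.
  exact/row_comb_down/row_comb_down/row_comb_refl.
- rewrite mul_col_mx VaA -mulmxA UA mulmxA.
  set C := col_mx (col_mx _ _) _.
  have hVa : row_comb Va^z C by apply/row_comb_down/row_comb_down/row_comb_refl.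
  apply: row_comb_trans spanVU (row_comb_col (row_comb_col _ hVa) _).
    exact/row_comb_down/row_comb_up/row_comb_refl.
  apply: row_comb_trans spanUV (row_comb_col _ _).
    exact/row_comb_up/row_comb_down/row_comb_refl.
  rewrite -[X in row_comb X _](addrK (z *: Va^z)).
  apply: row_combB; last exact: row_combZ.
  exact/row_comb_up/row_comb_up/row_comb_refl.
- rewrite diag_mx_row mul_col_mx mul_block_col !mul0mx addr0 add0r.
  rewrite VbA mulmxBl -!mulmxA VaA UA mulmxA X2A' mulmxDr !mulmxA addrAC subrr add0r.
  rewrite diag_const_mx mul_scalar_mx; congr col_mx.
  by rewrite -scalemxAr [diag_mx (z *: _)]linearZ -scalemxAl.
- move=> i j; case: (split_ordP i) => i' ->; case: (split_ordP j) => j' ->;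
    rewrite ?row_mxEl ?row_mxEr !mxE /=.
  + by exists 1; rewrite mul1r.
  + by exists (g' 0 j'); rewrite mulrC.
  + by rewrite leqNgt ltn_addr.
  + by rewrite leq_add2l => /chain [c ->]; exists c; rewrite mulrCA.
Qed.

Lemma smith_generators_scalar t (R : int) :
  smith_generators (R%:M : 'M[int]_t) 1%:M.
Proof.
move=> K y; exists 0%N, (const_mx (y + R%:~R)), 0, 1%:M; split=> //.
- exact/row_comb_down/row_comb_refl.
- by rewrite map_mx1; apply/row_comb_down/row_comb_refl.
- by rewrite mul1mx map_mx1 mulmx1 diag_const_mx map_scalar_mx addrC -raddfD.
- by move=> i j _; exists 1; rewrite !mxE mul1r.
Qed.

(** Here there is no room for the kernel row that [lift_generators] adds. The first basis vector
    alone lifts the generator, and subtracting it from (1, 1) gives the second. *)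
Lemma lift_rank_two t0 t1 (U : 'M[int]_(t0, t1)) :
  t0 = 1%N -> t1 = 2%N -> U = const_mx 1 ->
  exists2 Va : 'M[int]_(t0, t1), Va *m U^T = 1%:M &
    row_comb 1%:M (col_mx (col_mx (0 : 'M_(0, t1)) Va) U).
Proof.
move=> e0 e1 ->; subst t0 t1; exists (delta_mx 0 0).
  apply/matrixP=> i j; rewrite !ord1 !mxE big_ord_recl big_ord1 !mxE /=.
  by rewrite mulr1 mul0r addr0.
have -> : 1%:M = col_mx (delta_mx 0 0) (const_mx 1 - delta_mx 0 0) :> 'M[int]_(1 + 1).
  by apply/matrixP=> -[[|[|i]] hi] [[|[|j]] hj] //; rewrite !mxE;
    case: splitP => -[[|k] hk] // _; rewrite !mxE.
have span (e u : 'rV[int]_2) :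
    row_comb (col_mx e (u - e)) (col_mx (col_mx (0 : 'M[int]_(0, 2)) e) u).
  have he : row_comb e (col_mx (col_mx (0 : 'M[int]_(0, 2)) e) u).
    exact/row_comb_up/row_comb_down/row_comb_refl.
  apply: row_comb_col (he) (row_combB _ he).
  exact/row_comb_down/row_comb_refl.
exact: span.
Qed.

Lemma smith_generators_exist (t : nat -> nat)
    (U : forall n, 'M[int]_(t n, t n.+1)) (R : int) :
  U 0%N *m (U 0%N)^T = R%:M ->
  (forall n, U n.+1 *m (U n.+1)^T = (U n)^T *m U n + R%:M) ->
  (forall n, exists W, W *m (U n)^T = 1%:M) ->
  t 0%N = 1%N -> (1 < t 1%N)%N -> (t 1%N = 2%N -> U 0%N = const_mx 1) ->
  (forall n, (2 * t n.+1 < t n.+2 + t n)%N) ->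
  forall n, exists m (V : 'M[int]_(m, t n)),
    smith_generators (U n *m (U n)^T) V.
Proof.
move=> U0 US surjU t0 t1 U1 convex n.
(* Recording that [m] is [t n] minus the previous size, taken as 0 below rank 0, turns [convex] into
   the strict inequality needed for lifting. *)
suff [m [V [genV _]]] : exists m (V : 'M[int]_(m, t n)),
    smith_generators (U n *m (U n)^T) V
    /\ ((if n is n'.+1 then t n' else 0) + m = t n)%N by exists m, V.
elim: n => [|n [m' [V' [genV' em']]]].
  by exists (t 0), 1%:M; split; rewrite ?U0 //; apply: smith_generators_scalar.
(* At [n = 0] one has [m' = t 0 = 1], so the inequality reads [2 < t 1] and only [t 1 = 2]
   escapes. *)
have [[n0 t12] | lt_d] : (n = 0 /\ t 1 = 2)%N \/ (t n + m' < t n.+1)%N.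
  case: (n) em' => [|n'] em'; last by have := convex n'; lia.
  by have [t12 | t12] := leqP (t 1%N) 2%N; [left; split; lia | right; lia].
  subst n; have [Va VaU spanV] := lift_rank_two t0 t12 (U1 t12).
  exists (0 + t 0)%N, (col_mx 0 Va); split; last by rewrite /=; lia.
  rewrite US; apply: smith_generators_step VaU spanV _; last by lia.
    by rewrite U0; apply: smith_generators_scalar.
  by rewrite mul0mx.
have [W WU] := surjU n; pose d := (t n.+1 - (t n + m')).-1.
have et : (t n + (d.+1 + m') = t n.+1)%N by rewrite /d; lia.
have [Vb [Va [VbU VaU spanV]]] := lift_generators WU (smith_generators_span genV') et.
exists (d.+1 + m')%N, (col_mx Vb Va); split=> //.
by rewrite US; apply: smith_generators_step VaU spanV et.
Qed.

(** * Up and down operators on coefficient functions *)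

Section RankFunctions.
Variable P : gposet.
Implicit Types f : forall n, elt P n -> int.

(** Elements of Z P_n are represented by their coefficients, in all ranks at once, so that
    [down_map] and [up_map] compose freely. *)
Definition down_map f n (x : elt P n) : int := \sum_(z | cov x z) f n.+1 z.

Definition up_map f n : elt P n -> int :=
  match n with
  | 0 => fun=> 0
  | m.+1 => fun x => \sum_(w | cov w x) f m w
  end.

Lemma down_up_mapE f n (x : elt P n) :
  down_map (up_map f) x =
  \sum_y f n y *+ #|[pred z : elt P n.+1 | cov x z && cov y z]|.
Proof.
rewrite /down_map /= (exchange_big_dep predT) //=; apply: eq_bigr => y _.
by rewrite -sumr_const; apply: eq_bigl => z; rewrite inE.
Qed.

Lemma up_down_mapE f n (x : elt P n) :
  up_map (down_map f) x = \sum_y f n y *+ ncommon_down x y.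
Proof.
case: n x => [|n] x; first by rewrite big1.
rewrite /= /down_map (exchange_big_dep predT) //=; apply: eq_bigr => y _.
by rewrite -sumr_const; apply: eq_bigl => z; rewrite inE.
Qed.

Lemma ncommon_down_refl n (x : elt P n) : ncommon_down x x = ndown x.
Proof. by case: n x => // n x; apply: eq_card => w; rewrite !inE andbb. Qed.

(** Entrywise form of DU - UD = r, merging (D2) off the diagonal with (D3) on it. *)
Definition common_covers r := forall n (x y : elt P n),
  #|[pred z : elt P n.+1 | cov x z && cov y z]| = (ncommon_down x y + r * (x == y))%N.

Lemma differential_common_covers r : differential r P -> common_covers r.
Proof.
move=> [_ _ _ D2 D3] n x y; have [-> | nxy] := eqVneq x y.
  rewrite muln1 ncommon_down_refl -D3.
  by apply: eq_card => z; rewrite !inE andbb.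
by rewrite muln0 addn0 D2.
Qed.

Lemma down_up_map r f n (x : elt P n) : common_covers r ->
  down_map (up_map f) x = up_map (down_map f) x + f n x *+ r.
Proof.
move=> ccP; rewrite down_up_mapE up_down_mapE [in RHS](bigD1 x) //= (bigD1 x) //=.
rewrite ccP eqxx muln1 mulrnDr addrAC; congr (_ + _ + _).
by apply: eq_bigr => y nyx; rewrite ccP eq_sym (negPf nyx) muln0 addn0.
Qed.

Lemma common_covers_of_maps r :
  (forall f n (x : elt P n),
     down_map (up_map f) x = up_map (down_map f) x + f n x *+ r) ->
  common_covers r.
Proof.
move=> DU n x y.
(* The indicator of [y], compared through [Tagged] to make sense in every rank, extracts a single
   matrix entry. *)
pose f k (z : elt P k) : int := (Tagged (elt P) z == Tagged (elt P) y)%:R.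
have pick c : \sum_z f n z *+ c z = (c y)%:R.
  rewrite (bigD1 y) //= big1 => [|z nzy]; first by rewrite /f eqxx addr0.
  by rewrite /f eq_Tagged (negPf nzy) mul0rn.
have := DU f n x; rewrite down_up_mapE up_down_mapE !pick /f eq_Tagged /=.
by rewrite -mulrnA -mulrnDr mulnC => /eqP; rewrite eqr_nat => /eqP.
Qed.

Lemma down_sections : down_surjective P ->
  exists sec : forall n, elt P n -> elt P n.+1 -> int,
    forall n (y y' : elt P n), \sum_(x | cov y' x) sec n y x = (y == y')%:R.
Proof.
move=> surjP.
(* Finite functions form a choice type on which these equations are decidable, so [xchoose] can
   select the sections. *)
have ex n (y : elt P n) : exists w : {ffun elt P n.+1 -> int},
    [forall y', \sum_(x | cov y' x) w x == (y == y')%:R].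
  have [w wE] := surjP n (fun y' => (y == y')%:R).
  exists [ffun x => w x]; apply/forallP => y'; rewrite wE.
  by apply/eqP/eq_bigr => x _; rewrite ffunE.
exists (fun n y => (xchoose (ex n y) : {ffun _ -> _})) => n y y'.
by have /forallP/(_ y')/eqP := xchooseP (ex n y).
Qed.

End RankFunctions.

Lemma eq_down_map (R : gposet) (f g : forall n, elt R n -> int) n (x : elt R n) :
  (forall n x, f n x = g n x) -> down_map f x = down_map g x.
Proof. by move=> fg; apply: eq_bigr => z _. Qed.

Lemma eq_up_map (R : gposet) (f g : forall n, elt R n -> int) n (x : elt R n) :
  (forall n x, f n x = g n x) -> up_map f x = up_map g x.
Proof. by move=> fg; case: n x => //= n x; apply: eq_bigr => z _. Qed.

Lemma down_mapD (R : gposet) (f g : forall n, elt R n -> int) n (x : elt R n) :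
  down_map (fun n x => f n x + g n x) x = down_map f x + down_map g x.
Proof. exact: big_split. Qed.

Lemma up_mapD (R : gposet) (f g : forall n, elt R n -> int) n (x : elt R n) :
  up_map (fun n x => f n x + g n x) x = up_map f x + up_map g x.
Proof. by case: n x => [|n] x /=; [rewrite addr0 | apply: big_split]. Qed.

(** * Covers and operators in the product poset *)

Lemma tcovP (R : gposet) i (a : elt R i) (v : telt R) :
  reflect (exists2 c : elt R i.+1, cov a c & v = Tagged (elt R) c)
          (tcov (Tagged (elt R) a) v).
Proof.
apply: (iffP existsP) => [[a' /existsP[c /and3P[]]] | [c ac ->]].
  rewrite eq_Tagged /= => /eqP -> /eqP <- ac; by exists c.
by exists a; apply/existsP; exists c; rewrite !eqxx.
Qed.

Lemma tcov_up (R : gposet) i (c : elt R i) (u : telt R) :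
  tcov u (Tagged (elt R) c) -> (tag u).+1 = i.
Proof. by case: u => k a /tcovP[c' _ /(congr1 tag)]. Qed.

Lemma tcov_tagged (R : gposet) i (a : elt R i) (c : elt R i.+1) :
  tcov (Tagged (elt R) a) (Tagged (elt R) c) = cov a c.
Proof.
apply/tcovP/idP => [[c' ac' /eqP] | ac]; last by exists c.
by rewrite eq_Tagged /= => /eqP ->.
Qed.

Lemma tcov_irrefl (R : gposet) (u : telt R) : tcov u u = false.
Proof. by case: u => i a; apply/negbTE/negP => /(@tcov_up R i a) /=; lia. Qed.

Lemma sum_image (I J : finType) (h : I -> J) (A : pred I) (B : pred J) (F : J -> int) :
  injective h -> (forall y, reflect (exists2 x, A x & y = h x) (B y)) ->
  \sum_(y | B y) F y = \sum_(x | A x) F (h x).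
Proof.
move=> hinj BP; transitivity (\sum_(y in h @: [set x | A x]) F y).
  apply: eq_bigl => y; apply/BP/imsetP => -[x Ax ->]; exists x => //; first by rewrite inE.
  by rewrite inE in Ax.
by rewrite big_imset; [apply: eq_bigl => x; rewrite inE | move=> x y _ _ /hinj].
Qed.

Lemma sum_orb (I : finType) (B1 B2 : pred I) (F : I -> int) :
  (forall x, ~~ (B1 x && B2 x)) ->
  \sum_(x | B1 x || B2 x) F x = \sum_(x | B1 x) F x + \sum_(x | B2 x) F x.
Proof.
move=> disj; rewrite (bigID B1) /=; congr (_ + _); apply: eq_bigl => x.
  by case: (B1 x); case: (B2 x).
by have := disj x; case: (B1 x); case: (B2 x).
Qed.

Section Product.
Variables P Q : gposet.
Local Notation T := (prod_poset P Q).

Definition pfst n (x : elt T n) : telt P := Tagged (elt P) (tagged x).1.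
Definition psnd n (x : elt T n) : telt Q := Tagged (elt Q) (tagged x).2.

Lemma prod_covE n (x : elt T n) (z : elt T n.+1) :
  cov x z = (tcov (pfst x) (pfst z) && (psnd x == psnd z))
         || ((pfst x == pfst z) && tcov (psnd x) (psnd z)).
Proof. by []. Qed.

Lemma prod_ext n (x y : elt T n) : pfst x = pfst y -> psnd x = psnd y -> x = y.
Proof.
case: x y => i [a b] [i' [a' b']].
rewrite /pfst /psnd /= => Ea Eb.
have ei : i = i' by apply: val_inj; apply: (congr1 tag Ea).
subst i'; move/eqP: Ea; move/eqP: Eb.
by rewrite !eq_Tagged /= => /eqP -> /eqP ->.
Qed.

Fact mk_prod_ltn n i j : (i + j = n)%N -> (i < n.+1)%N. Proof. by lia. Qed.
Fact mk_prod_sub n i j : (i + j = n)%N -> j = (n - i)%N. Proof. by lia. Qed.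

(** Two free ranks with a proof of their sum avoid the subtraction [n - i] of [prod_elt]; the cast
    is confined to this definition. *)
Definition mk_prod n i j (e : (i + j = n)%N) (a : elt P i) (b : elt Q j) : elt T n :=
  Tagged (fun k : 'I_n.+1 => (elt P k * elt Q (n - k))%type)
    (i := Ordinal (mk_prod_ltn e))
    (a, ecast k (elt Q k) (mk_prod_sub e) b).

Lemma pfst_mk n i j (e : (i + j = n)%N) a b :
  pfst (mk_prod e a b) = Tagged (elt P) a.
Proof. by []. Qed.

Lemma psnd_mk n i j (e : (i + j = n)%N) a b :
  psnd (mk_prod e a b) = Tagged (elt Q) b.
Proof. by rewrite /psnd /=; case: _ / (mk_prod_sub e). Qed.

Definition mkE := (pfst_mk, psnd_mk).

Variant mk_prod_spec n : elt T n -> Prop :=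
  MkProdSpec i j (e : (i + j = n)%N) a b : mk_prod_spec (mk_prod e a b).

Lemma mk_prodP n (x : elt T n) : mk_prod_spec x.
Proof.
have e : (tag x + (n - tag x) = n)%N by rewrite subnKC // -ltnS.
suff -> : x = mk_prod e (tagged x).1 (tagged x).2 by [].
by apply: prod_ext; rewrite mkE.
Qed.

Lemma mk_prod_injl n i j (e : (i + j = n)%N) b :
  injective (fun a : elt P i => mk_prod e a b).
Proof.
move=> a a' /(congr1 (@pfst n)) /eqP; rewrite !mkE.
by rewrite eq_Tagged => /eqP.
Qed.

Lemma mk_prod_injr n i j (e : (i + j = n)%N) a :
  injective (fun b : elt Q j => mk_prod e a b).
Proof.
move=> b b' /(congr1 (@psnd n)) /eqP; rewrite !mkE.
by rewrite eq_Tagged => /eqP.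
Qed.

Fact eqSl i j n : (i + j = n)%N -> (i.+1 + j = n.+1)%N. Proof. by lia. Qed.
Fact eqSr i j n : (i + j = n)%N -> (i + j.+1 = n.+1)%N. Proof. by lia. Qed.

(** The down map of the product is the sum of the down maps of the factors: a cover moves up in
    exactly one coordinate, since nothing covers itself. *)
Lemma sum_covers_mk n i j (e : (i + j = n)%N) a b (F : elt T n.+1 -> int) :
  \sum_(z | cov (mk_prod e a b) z) F z =
  \sum_(c | cov a c) F (mk_prod (eqSl e) c b) +
  \sum_(d | cov b d) F (mk_prod (eqSr e) a d).
Proof.
under eq_bigl => z do rewrite prod_covE !mkE.
rewrite sum_orb; last first.
  move=> z; apply/negP => /andP[/andP[h _] /andP[/eqP h' _]].
  by rewrite -h' tcov_irrefl in h.
congr (_ + _); apply: sum_image.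
- exact: mk_prod_injl.
- move=> z; apply: (iffP andP) => [[/tcovP[c ac zc] /eqP zb] | [c ac ->]].
    by exists c => //; apply: prod_ext; rewrite mkE.
  by rewrite !mkE tcov_tagged.
- exact: mk_prod_injr.
- move=> z; apply: (iffP andP) => [[/eqP za /tcovP[d bd zd]] | [d bd ->]].
    by exists d => //; apply: prod_ext; rewrite mkE.
  by rewrite !mkE tcov_tagged.
Qed.

Lemma sum_covered_mk n i j (e : (i + j = n.+1)%N) a b (F : elt T n -> int) :
  \sum_(w | cov w (mk_prod e a b)) F w =
  match i return (i + j = n.+1)%N -> elt P i -> int with
  | 0 => fun _ _ => 0
  | i'.+1 => fun e' a' => \sum_(c | cov c a') F (mk_prod (eq_add_S _ _ e') c b)
  end e a +
  match j return (i + j = n.+1)%N -> elt Q j -> int with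
  | 0 => fun _ _ => 0
  | j'.+1 => fun e' b' =>
      \sum_(d | cov d b') F (mk_prod (eq_add_S _ _ (etrans (esym (addnS i j')) e')) a d)
  end e b.
Proof.
under eq_bigl => w do rewrite prod_covE !mkE.
rewrite sum_orb; last first.
  move=> z; apply/negP => /andP[/andP[h _] /andP[/eqP h' _]].
  by rewrite h' tcov_irrefl in h.
congr (_ + _).
  case: i e a => [|i] e a.
    by rewrite big1 // => w /andP[/tcov_up].
  apply: sum_image => [|w]; first exact: mk_prod_injl.
  apply: (iffP andP) => [|[c ca ->]]; last by rewrite !mkE tcov_tagged.
    case: (mk_prodP w) => i' j' e' a' b'; rewrite !mkE => -[wa /eqP wb].
    have /= [ei] := tcov_up wa; subst i'.
    move: wa; rewrite tcov_tagged => wa; exists a' => //.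
    by apply: prod_ext; rewrite !mkE.
case: j e b => [|j] e b.
  by rewrite big1 // => w /andP[_ /tcov_up].
apply: sum_image => [|w]; first exact: mk_prod_injr.
apply: (iffP andP) => [|[d db ->]]; last by rewrite !mkE tcov_tagged.
  case: (mk_prodP w) => i' j' e' a' b'; rewrite !mkE => -[/eqP wa wb].
  have /= [ej] := tcov_up wb; subst j'.
  move: wb; rewrite tcov_tagged => wb; exists b' => //.
  by apply: prod_ext; rewrite !mkE.
Qed.

Section Extension.
Variable f : forall n, elt T n -> int.

Definition pair_fun i (a : elt P i) j (b : elt Q j) : int := f (mk_prod erefl a b).

Lemma pair_funE n i j (e : (i + j = n)%N) a b : f (mk_prod e a b) = pair_fun a b.
Proof. by case: n / e. Qed.

Lemma down_map_mk n i j (e : (i + j = n)%N) a b :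
  down_map f (mk_prod e a b) =
  down_map (fun k (c : elt P k) => pair_fun c b) a + down_map (@pair_fun i a) b.
Proof.
by rewrite /down_map sum_covers_mk; congr (_ + _); apply: eq_bigr => c _;
  rewrite pair_funE.
Qed.

Lemma up_map_mk n i j (e : (i + j = n)%N) a b :
  up_map f (mk_prod e a b) =
  up_map (fun k (c : elt P k) => pair_fun c b) a + up_map (@pair_fun i a) b.
Proof.
case: n e => [|n] e.
  by case: i e a => // -e; case: j e b => //= e b a; rewrite addr0.
rewrite [LHS]sum_covered_mk; congr (_ + _).
  by case: i e a => //= i e a; apply: eq_bigr => c _; rewrite pair_funE.
by case: j e b => //= j e b; apply: eq_bigr => c _; rewrite pair_funE.
Qed.

End Extension.

Lemma down_up_mapC (F : forall i, elt P i -> forall j, elt Q j -> int) i j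
    (a : elt P i) (b : elt Q j) :
  down_map (fun k (c : elt P k) => up_map (F k c) b) a =
  up_map (fun l (d : elt Q l) => down_map (fun k (c : elt P k) => F k c l d) a) b.
Proof.
case: j b => [|j] b /=; first by rewrite /down_map big1.
by rewrite /down_map exchange_big.
Qed.

Lemma up_down_mapC (F : forall i, elt P i -> forall j, elt Q j -> int) i j
    (a : elt P i) (b : elt Q j) :
  up_map (fun k (c : elt P k) => down_map (F k c) b) a =
  down_map (fun l (d : elt Q l) => up_map (fun k (c : elt P k) => F k c l d) a) b.
Proof.
case: i a => [|i] a /=; first by rewrite /down_map big1.
by rewrite /down_map exchange_big.
Qed.

(** Up and down maps acting on different factors commute, so the commutator of D_P + D_Q with U_P +
    U_Q is the sum of the two commutators, r + s. *)
Lemma prod_common_covers r s :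
  common_covers P r -> common_covers Q s -> common_covers T (r + s).
Proof.
move=> ccP ccQ; apply: common_covers_of_maps => f n x.
case: (mk_prodP x) => i j e a b; rewrite down_map_mk up_map_mk pair_funE.
set F := pair_fun f.
have upE k (c : elt P k) l (d : elt Q l) : pair_fun (up_map f) c d =
    up_map (fun k (c : elt P k) => F k c l d) c + up_map (F k c) d.
  exact: up_map_mk.
have downE k (c : elt P k) l (d : elt Q l) : pair_fun (down_map f) c d =
    down_map (fun k (c : elt P k) => F k c l d) c + down_map (F k c) d.
  exact: down_map_mk.
rewrite (eq_down_map (g := fun k c => up_map (fun k (c : elt P k) => F k c j b) c
                                      + up_map (F k c) b)) //.
rewrite (eq_down_map (g := fun l d => up_map (fun k (c : elt P k) => F k c l d) a
                                      + up_map (F i a) d)) //.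
rewrite (eq_up_map (g := fun k c => down_map (fun k (c : elt P k) => F k c j b) c
                                      + down_map (F k c) b)) //.
rewrite (eq_up_map (g := fun l d => down_map (fun k (c : elt P k) => F k c l d) a
                                      + down_map (F i a) d)) //.
rewrite !down_mapD !up_mapD (down_up_map _ _ ccP) (down_up_map _ _ ccQ).
rewrite down_up_mapC up_down_mapC mulrnDr.
ring.
Qed.

End Product.

(* Solving D_A G = F - D_B G rank by rank in A: the right-hand side at rank i
   only involves G at rank i of A. *)
Lemma down_sum_surjective (A B : gposet) : down_surjective A ->
  forall F : (forall i, elt A i -> forall j, elt B j -> int),
  exists G : (forall i, elt A i -> forall j, elt B j -> int),
  forall i (a : elt A i) j (b : elt B j),
    down_map (fun k (c : elt A k) => G k c j b) a + down_map (G i a) b = F i a j b.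
Proof.
move=> /down_sections[sec secE] F.
(* The value at rank 0 is free; once rank [k] is fixed, the section of D_A solves for rank
   [k.+1]. *)
pose G := fix G i : elt A i -> forall j, elt B j -> int :=
  match i with
  | 0 => fun _ _ _ => 0
  | k.+1 => fun c j b => \sum_y sec k y c * (F k y j b - down_map (G k y) b)
  end.
exists G => i a j b; rewrite {1}/down_map /= exchange_big /=.
under eq_bigr => y _ do rewrite -mulr_suml secE.
rewrite (bigD1 a) //= big1 => [|y /negPf nya]; last by rewrite nya mul0r.
by rewrite eqxx mul1r addr0 subrK.
Qed.

Lemma prod_down_surjective (P Q : gposet) :
  down_surjective P \/ down_surjective Q -> down_surjective (prod_poset P Q).
Proof.
move=> surj n v.
(* Extending [v] by zero off [i + j = n] lets all pairs of ranks be solved together. *)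
pose F i (a : elt P i) j (b : elt Q j) : int :=
  if (i + j)%N =P n is ReflectT e then v (mk_prod e a b) else 0.
have [G GE] : exists G : (forall i, elt P i -> forall j, elt Q j -> int),
  forall i (a : elt P i) j (b : elt Q j),
    down_map (fun k (c : elt P k) => G k c j b) a + down_map (G i a) b = F i a j b.
  case: surj => [surjP | surjQ]; first exact: down_sum_surjective.
  have [G GE] := down_sum_surjective surjQ (fun j b i a => F i a j b).
  by exists (fun i a j b => G j b i a) => i a j b; rewrite -GE addrC.
pose w (z : elt (prod_poset P Q) n.+1) := G _ (tagged (pfst z)) _ (tagged (psnd z)).
have wE i j (e : (i + j = n.+1)%N) a b : w (mk_prod e a b) = G i a j b.
  by rewrite /w psnd_mk.
exists w => x; case: (mk_prodP x) => i j e a b.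
rewrite sum_covers_mk.
under eq_bigr do rewrite wE.
under [X in _ + X]eq_bigr do rewrite wE.
rewrite [RHS]GE /F; case: eqP => // e'.
by rewrite (eq_irrelevance e e').
Qed.

Lemma rksize_prod (P Q : gposet) n :
  rksize (prod_poset P Q) n = (\sum_(i < n.+1) rksize P i * rksize Q (n - i))%N.
Proof.
rewrite /rksize /= card_tagged sumnE big_map big_enum /=.
by apply: eq_bigr => i _; rewrite card_prod.
Qed.

(** * Matrices of the up maps *)

Section UpMatrix.
Variable P : gposet.

(** Acting on row vectors from the right, this is U_n and its transpose is D_(n+1). *)
Definition upmx n : 'M[int]_(#|elt P n|, #|elt P n.+1|) :=
  \matrix_(i, j) (cov (enum_val i) (enum_val j))%:R.

Lemma sum_enum_val (T : finType) (F : T -> int) :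
  \sum_(i < #|T|) F (enum_val i) = \sum_x F x.
Proof. by rewrite -(big_enum_val F); apply: eq_bigl. Qed.

Lemma upmx_tr n i j : (upmx n *m (upmx n)^T) i j =
  (#|[pred z : elt P n.+1 | cov (enum_val i) z && cov (enum_val j) z]|)%:R.
Proof.
rewrite mxE; under eq_bigr => k _ do rewrite !mxE.
rewrite (sum_enum_val (fun z => (cov (enum_val i) z)%:R * (cov (enum_val j) z)%:R)).
rewrite -sum1_card natr_sum [RHS]big_mkcond; apply: eq_bigr => z _.
by rewrite inE; case: (cov _ z); case: (cov _ z); rewrite ?mulr1 ?mulr0.
Qed.

Lemma tr_upmx n i j : ((upmx n)^T *m upmx n) i j =
  (ncommon_down (enum_val i) (enum_val j))%:R.
Proof.
rewrite mxE; under eq_bigr => k _ do rewrite !mxE.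
rewrite (sum_enum_val (fun z => (cov z (enum_val i))%:R * (cov z (enum_val j))%:R)).
rewrite [ncommon_down _ _]/= -sum1_card natr_sum [RHS]big_mkcond; apply: eq_bigr => z _.
by rewrite inE; case: (cov z _); case: (cov z _); rewrite ?mulr1 ?mulr0.
Qed.

Lemma upmx0 r : common_covers P r -> upmx 0 *m (upmx 0)^T = (r%:Z)%:M.
Proof.
move=> cc; apply/matrixP => i j; rewrite upmx_tr cc mxE add0n.
by rewrite (inj_eq enum_val_inj); case: eqP; rewrite ?muln0 ?muln1 ?natz.
Qed.

Lemma upmxS r n : common_covers P r ->
  upmx n.+1 *m (upmx n.+1)^T = (upmx n)^T *m upmx n + (r%:Z)%:M.
Proof.
move=> cc; apply/matrixP => i j; rewrite [RHS]mxE upmx_tr cc tr_upmx mxE.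
by rewrite (inj_eq enum_val_inj) natrD; congr (_ + _); case: eqP; rewrite ?muln0 ?muln1 ?natz.
Qed.

Lemma upmx_left_inverse n : down_surjective P ->
  exists W, W *m (upmx n)^T = 1%:M.
Proof.
move=> /down_sections[sec secE].
exists (\matrix_(i, j) sec n (enum_val i) (enum_val j)).
apply/matrixP => i j; rewrite !mxE; under eq_bigr => k _ do rewrite !mxE.
rewrite (sum_enum_val (fun z => sec n (enum_val i) z * (cov (enum_val j) z)%:R)).
rewrite -(inj_eq enum_val_inj) -secE [RHS]big_mkcond; apply: eq_bigr => z _.
by case: cov; rewrite ?mulr1 ?mulr0.
Qed.

Lemma DUmxE n : DUmx P n = map_mx intr (upmx n *m (upmx n)^T).
Proof. by apply/matrixP => i j; rewrite [RHS]mxE upmx_tr mxE rmorph_nat. Qed.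

(* U is injective because v U U^T v^T = |v U'^T|^2 + r |v|^2. *)
Lemma rksize_leS r n : (0 < r)%N -> common_covers P r -> (rksize P n <= rksize P n.+1)%N.
Proof.
move=> r_gt0 cc; rewrite leqNgt; apply/negP => lt_rk.
have [c [u [Uc uc]]] := primitive_annihilator (upmx n)^T lt_rk.
have sq_ge0 k (w : 'cV[int]_k) : 0 <= (w^T *m w) 0 0.
  by rewrite mxE; apply: sumr_ge0 => l _; rewrite mxE -expr2 sqr_ge0.
have UUc : c^T *m (upmx n *m (upmx n)^T) *m c = 0.
  by rewrite -!mulmxA Uc !mulmx0.
have le0 : r%:Z * (c^T *m c) 0 0 <= 0.
  case: n c u Uc uc UUc {lt_rk} => [|n] c u Uc uc.
    rewrite (upmx0 cc) mul_mx_scalar -scalemxAl => /matrixP/(_ 0 0).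
    by rewrite [LHS]mxE => ->; rewrite mxE.
  rewrite (upmxS _ cc) mulmxDr mul_mx_scalar mulmxDl -scalemxAl => /matrixP/(_ 0 0).
  rewrite [LHS]mxE [X in _ + X]mxE mulmxA -mulmxA -trmx_mul [RHS]mxE => /eqP.
  by rewrite addrC addr_eq0 => /eqP ->; rewrite oppr_le0 sq_ge0.
have c0 : (c^T *m c) 0 0 = 0.
  by apply/eqP; rewrite eq_le sq_ge0 andbT; move: le0; rewrite pmulr_rle0 // ltz_nat.
suff cz : c = 0 by move/matrixP/(_ 0 0): uc; rewrite cz mulmx0 !mxE.
apply/colP => i; rewrite [RHS]mxE; apply/eqP; rewrite -sqrf_eq0.
move/eqP: c0; rewrite mxE psumr_eq0 => [/allP/(_ i)|l _]; last by rewrite mxE -expr2 sqr_ge0.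
by rewrite mem_index_enum mxE -expr2; apply.
Qed.

End UpMatrix.

(** * Rank sizes and strict convexity for the product *)

Section RankSizes.
Variables (r : nat) (P : gposet).
Hypothesis diffP : differential r P.

Lemma cov_bottom (x : elt P 0) (y : elt P 1) : cov x y.
Proof.
have [_ card0 bot _ _] := diffP; have [x' x'y] := bot 0%N y.
by rewrite -(fintype_le1P (eq_leq card0) x x').
Qed.

Lemma rksize0 : rksize P 0 = 1%N. Proof. by have [] := diffP. Qed.

Lemma rank_nonempty n : (0 < rksize P n)%N.
Proof.
have [r_gt0 card0 _ _ D3] := diffP; elim: n => [|n]; first by rewrite rksize0.
move=> /card_gt0P[x _]; have : (0 < #|[pred z : elt P n.+1 | cov x z]|)%N.
  by rewrite D3 ltn_addl.
by case/card_gt0P => z _; apply/card_gt0P; exists z.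
Qed.

Lemma rksize1 : rksize P 1 = r.
Proof.
have [_ _ _ _ D3] := diffP; have /card_gt0P[x _] := rank_nonempty 0.
have := D3 0%N x; rewrite add0n => <-; apply: eq_card => z.
by rewrite !inE cov_bottom.
Qed.

(** An element of rank 1 covers only the minimum, so [1 + r] elements of rank 2 cover it. *)
Lemma rksize2 : (r < rksize P 2)%N.
Proof.
have [r_gt0 _ _ _ D3] := diffP; have /card_gt0P[x _] := rank_nonempty 1.
have /= := D3 1%N x; have -> : #|[pred w : elt P 0 | cov w x]| = 1%N.
  by rewrite -rksize0; apply: eq_card => z; rewrite !inE cov_bottom.
by rewrite add1n => <-; apply: max_card.
Qed.

End RankSizes.

(** The second difference is a sum of p_i times second differences of q for i < n, plus the boundary
    terms p_n (q_2 - 2 s + 1) + p_(n+1) (s - 2) + p_(n+2). Convexity of q makes all but the last two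
    terms nonnegative. *)
Lemma rksize_prod_convex r s (P Q : gposet) :
  differential r P -> differential s Q ->
  (forall n : nat, (2 <= n)%N ->
     (rksize Q n)%:Z - (rksize Q n.-1)%:Z >= (rksize Q n.-1)%:Z - (rksize Q n.-2)%:Z) ->
  forall n, (2 * rksize (prod_poset P Q) n.+1 <
             rksize (prod_poset P Q) n.+2 + rksize (prod_poset P Q) n)%N.
Proof.
move=> dP dQ hq n; rewrite !rksize_prod.
set p := rksize P; set q := rksize Q.
have q0 : q 0%N = 1%N := rksize0 dQ.
have q1 : q 1%N = s := rksize1 dQ.
have q2 : (s < q 2)%N := rksize2 dQ.
have s_gt0 : (0 < s)%N by case: dQ.
have p_le : (p n.+1 <= p n.+2)%N.
  by case: (dP) => r_gt0 _ _ _ _; apply: rksize_leS r_gt0 (differential_common_covers dP).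
have p_gt0 k : (0 < p k)%N := rank_nonempty dP k.
have q_convex k : (2 * q k.+1 <= q k.+2 + q k)%N by have := hq k.+2 isT; rewrite /= -/q; lia.
pose S m := (\sum_(i < n) p i * q (m + (n - i)))%N.
have SE m : (\sum_(i < n) p i * q (m + n - i) = S m)%N.
  by apply: eq_bigr => i _; rewrite addnBA // ltnW.
have e0 : (\sum_(i < n.+1) p i * q (n - i) = S 0%N + p n)%N.
  by rewrite big_ord_recr /= -[X in (X + _)%N](SE 0%N) subnn q0 muln1.
have e1 : (\sum_(i < n.+2) p i * q (n.+1 - i) = S 1%N + p n * s + p n.+1)%N.
  by rewrite !big_ord_recr /= -(SE 1%N) subnn subSnn q0 q1 muln1.
have e2 : (\sum_(i < n.+3) p i * q (n.+2 - i) =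
           S 2 + p n * q 2 + p n.+1 * s + p n.+2)%N.
  rewrite !big_ord_recr /= -(SE 2%N) subnn subSnn q0 q1 muln1.
  by have -> : (n.+2 - n = 2)%N by lia.
rewrite e0 e1 e2.
have le_sum : (2 * S 1%N <= S 2 + S 0)%N.
  rewrite big_distrr -big_split /=; apply: leq_sum => i _.
  by rewrite mulnCA -mulnDr leq_mul.
have xs : (2 * (p n * s) <= p n * q 2 + p n)%N.
  have := q_convex 0%N; rewrite q0 q1 => le_s.
  by rewrite mulnCA -[X in (_ + X)%N]muln1 -mulnDr leq_mul.
(* For s = 1 the bound q_2 >= 2 gives strictness and p_(n+1) <= p_(n+2) covers the negative term;
   for s >= 2 strictness comes from p_(n+2) > 0. *)
have [s1 | s_gt1] := leqP s 1.
  have -> : s = 1%N by lia.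
  have xq : (p n * 2 <= p n * q 2)%N by rewrite leq_mul //; lia.
  by have := p_gt0 n; lia.
have ys : (p n.+1 * 2 <= p n.+1 * s)%N by rewrite leq_mul.
by have := p_gt0 n.+2; lia.
Qed.

(** By counting: the [r] covers of [x] already exhaust rank 1. *)
Lemma cov_rank0 (P : gposet) r (x : elt P 0) (y : elt P 1) :
  common_covers P r -> rksize P 1 = r -> cov x y.
Proof.
move=> cc rk1; have := cc 0%N x x; rewrite eqxx muln1 add0n -rk1 => cardx.
have /subset_cardP/(_ (subset_predT _))/(_ y) : #|[pred z | cov x z && cov x z]| = #|elt P 1|.
  exact: cardx.
by rewrite !inE andbb.
Qed.

Unset Implicit Arguments.

Theorem mainTheorem7 (r s : nat) (P Q : gposet)
  (hP : differential r P) (hQ : differential s Q)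
  (hq : forall n : nat, (2 <= n)%N ->
     ((rksize Q n)%:Z - (rksize Q n.-1)%:Z >=
      (rksize Q n.-1)%:Z - (rksize Q n.-2)%:Z)%R)
  (hsurj : down_surjective P \/ down_surjective Q) :
  forall n : nat, has_SNF (DUmx (prod_poset P Q) n + ('X)%:M)%R.
Proof.
move=> n; set T := prod_poset P Q.
have ccT : common_covers T (r + s).
  exact: prod_common_covers (differential_common_covers hP) (differential_common_covers hQ).
have surjT := prod_down_surjective hsurj.
have T0 : rksize T 0 = 1%N.
  by rewrite rksize_prod big_ord1 (rksize0 hP) (rksize0 hQ).
have T1 : rksize T 1 = (r + s)%N.
  rewrite rksize_prod big_ord_recl big_ord1 /= (rksize0 hP) (rksize0 hQ).
  by rewrite (rksize1 hP) (rksize1 hQ) mul1n muln1 addnC.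
have T1_gt1 : (1 < rksize T 1)%N.
  by case: hP hQ => r_gt0 _ _ _ _ [s_gt0 _ _ _ _]; rewrite T1; lia.
have U0 : upmx T 0 = const_mx 1.
  by apply/matrixP => i j; rewrite !mxE (cov_rank0 _ _ ccT T1).
have [m [V genV]] := smith_generators_exist (upmx0 ccT) (fun k => upmxS k ccT)
  (fun k => upmx_left_inverse k surjT) T0 T1_gt1 (fun=> U0)
  (rksize_prod_convex hP hQ hq) n.
(* The generators are specialised to [K] the ring of integer polynomials and [y = 'X]. *)
by rewrite DUmxE; apply: smith_generators_SNF genV.
Qed.
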